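(* Let $p$ be an odd prime and let $q\in\mathbb{C}_p$ with $|q-1|_p<1$. Let $f\in UD(\mathbb{Z}_p)$, let $n\in\mathbb{N}$ ($n\ge1$), and let $f_n(x)=f(x+n)$. Then $$q^{n}I_{-q}(f_n)=(-1)^nI_{-q}(f)+[2]_q\sum_{l=0}^{n-1}(-1)^{n-1-l}q^l f(l).$$ In particular, if $n$ is an odd positive integer, then $$q^{n}I_{-q}(f_n)+I_{-q}(f)=[2]_q\sum_{l=0}^{n-1}(-1)^{l}q^l f(l).$$
   Context: $\mathbb{C}_p$ is the completion of the algebraic closure of $\mathbb{Q}_p$, with absolute value normalized by $|p|_p=1/p$. $UD(\mathbb{Z}_p)$ is the set of functions $f:\mathbb{Z}_p\to\mathbb{C}_p$ that are uniformly differentiable at every point $a\in\mathbb{Z}_p$, meaning that the difference quotient $\frac{f(x)-f(y)}{x-y}$ (for $x\neq y$) has a limit as $(x,y)\to(a,a)$. Notation: $[2]_q=1+q$, and for an integer $x\ge 0$, $[x]_{-q}=\frac{1-(-q)^x}{1+q}$. The fermionic $p$-adic $q$-integral of $f$ is $$I_{-q}(f)=\int_{\mathbb{Z}_p}f(x)\,d\mu_{-q}(x)=\lim_{N\to\infty}\frac{1}{[p^N]_{-q}}\sum_{x=0}^{p^N-1}f(x)(-q)^x .$$ *)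

(* Defs.v *)
From HB Require Import structures.
From mathcomp Require Export all_boot all_order all_algebra.
From mathcomp Require Export all_classical all_reals all_analysis.
Export Order.TTheory GRing.Theory Num.Theory.
Export numFieldNormedType.Exports.

Set Implicit Arguments.
Unset Strict Implicit.
Unset Printing Implicit Defensive.

Local Open Scope classical_set_scope.
Local Open Scope ring_scope.

HB.mixin Record Field_isUltrametric (R : realType) K & GRing.Field K := {
  absv : K -> R;
  absv_ge0 : forall x, 0 <= absv x;
  absv_eq0 : forall x, (absv x == 0) = (x == 0);
  absvM : forall x y, absv (x * y) = absv x * absv y;
  absvD : forall x y, absv (x + y) <= Num.max (absv x) (absv y)
}.

(* Fields with a non-archimedean absolute value. The library's normed modules
   do not apply: they require the norm of x *+ n to be n times that of x. *)
#[short(type="ultrametricFieldType")]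
HB.structure Definition UltrametricField (R : realType) :=
  {K of GRing.Field K & Field_isUltrametric R K}.

Section UltrametricTopology.
Context {R : realType} (K : ultrametricFieldType R).
Implicit Types x y z : K.

Lemma absv0 : absv (0 : K) = 0.
Proof. by apply/eqP; rewrite absv_eq0. Qed.

Lemma absv1 : absv (1 : K) = 1.
Proof.
have n1 : absv (1 : K) != 0 by rewrite absv_eq0 oner_neq0.
by apply: (mulfI n1); rewrite -absvM !mulr1.
Qed.

Lemma absvN x : absv (- x) = absv x.
Proof.
apply/eqP; rewrite -(@eqrXn2 _ 2) ?absv_ge0 //.
by rewrite !expr2 -!absvM mulrNN.
Qed.

Let dist x y : R := absv (x - y).

Let distxx x : dist x x = 0.
Proof. by rewrite /dist subrr absv0. Qed.

Let dist_positivity x y : dist x y = 0 -> x = y.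
Proof. by move/eqP; rewrite absv_eq0 subr_eq0 => /eqP. Qed.

Let dist_sym x y : dist x y = dist y x.
Proof. by rewrite /dist -absvN opprB. Qed.

Let dist_triangle y x z : dist x z <= dist x y + dist y z.
Proof.
rewrite /dist -(subrKA y); apply: le_trans (absvD _ _) _.
by rewrite ge_max lerDl lerDr !absv_ge0.
Qed.

HB.instance Definition _ := isPointed.Build (UltrametricField.sort K) 0.
HB.instance Definition _ := isMetric.Build R (UltrametricField.sort K)
  distxx dist_positivity dist_sym dist_triangle.

Definition is_complete : Prop :=
  forall F : set_system K, ProperFilter F -> cauchy F -> cvg F.

Definition vint : {pred K} := fun x => absv x <= 1.

Lemma vint_subring_closed : subring_closed vint.
Proof.
split => [|x y|x y]; rewrite /in_mem /= /vint.
- by rewrite absv1.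
- move=> x1 y1; apply: le_trans (absvD _ _) _.
  by rewrite ge_max absvN x1.
- by move=> x1 y1; rewrite absvM mulr_ile1 ?absv_ge0.
Qed.

HB.instance Definition _ := GRing.isSubringClosed.Build K vint
  vint_subring_closed.

(* The closed unit ball, a subring of K with the induced topology. *)
Record vring := VRing { vring_val : K; _ : vring_val \in vint }.

HB.instance Definition _ := [isSub for vring_val].
HB.instance Definition _ := [Choice of vring by <:].
HB.instance Definition _ := [SubChoice_isSubComNzRing of vring by <:].
HB.instance Definition _ :=
  PseudoMetric.copy vring (initial_topology vring_val).

End UltrametricTopology.

Definition padic_abs (R : realType) (p : nat) (x : rat) : R :=
  if x == 0 then 0
  else p%:R ^ ((logn p `|denq x|)%:Z - (logn p `|numq x|)%:Z).

(* K is Q_p, the completion of Q for the p-adic absolute value. No separate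
   characteristic assumption is needed: the second clause makes ratr injective. *)
Definition is_padic_numbers (R : realType) (p : nat)
    (K : ultrametricFieldType R) : Prop :=
  [/\ is_complete K,
      forall x : rat, absv (ratr x : K) = padic_abs R p x
    & dense (range (ratr : rat -> K))].

Definition is_algebraic_closure (F E : fieldType) (i : {rmorphism F -> E}) :
    Prop :=
  GRing.closed_field_axiom E /\ (forall z : E, algebraicOver i z).

Definition is_isometric (R : realType) (K L : ultrametricFieldType R)
    (i : K -> L) : Prop :=
  forall x : K, absv (i x) = absv x.

Definition is_completion (R : realType) (K L : ultrametricFieldType R)
    (i : {rmorphism K -> L}) : Prop :=
  [/\ is_complete L, is_isometric i & dense (range i)].

(* iota is the embedding of Q_p into C_p: the composite of an algebraic closure
   Q_p -> Qbar_p, with the absolute value of Q_p extended to Qbar_p, and of a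
   completion Qbar_p -> C_p. *)
Definition is_padic_complex_numbers (R : realType) (p : nat)
    (Qp Cp : ultrametricFieldType R) (iota : {rmorphism Qp -> Cp}) : Prop :=
  is_padic_numbers p Qp /\
  exists (Qpbar : ultrametricFieldType R) (i : {rmorphism Qp -> Qpbar})
      (j : {rmorphism Qpbar -> Cp}),
    [/\ is_algebraic_closure i, is_isometric i, is_completion j
      & iota =1 j \o i].

Section FermionicIntegral.
Context {R : realType} {Qp Cp : ultrametricFieldType R}.
Local Notation Zp := (vring Qp).

(* f : Z_p -> C_p has a strict derivative at every point of Z_p. *)
Definition uniformly_differentiable (iota : Qp -> Cp) (f : Zp -> Cp) : Prop :=
  forall a : Zp,
    cvg ((fun z : Zp * Zp => (f z.1 - f z.2) / iota (val (z.1 - z.2)))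
           @ within [set z | z.1 != z.2] (nbhs (a, a))).

Definition qbracket_neg (q : Cp) (x : nat) : Cp :=
  (1 - (- q) ^+ x) / (1 + q).

Definition fermionic_integral (p : nat) (q : Cp) (f : Zp -> Cp) : Cp :=
  lim ((fun N : nat => (qbracket_neg q (p ^ N))^-1 *
                         \sum_(x < p ^ N) f x%:R * (- q) ^+ x) @ \oo).

End FermionicIntegral.

(* Main.v *)
(* Write [T_N g] for the sum of [g x * (- q) ^+ x] over [x < p ^ N]. Splitting
   [x < p ^ N.+1] by residues modulo [p ^ N], and using that [p] is odd,
   [T_(N+1) g - T_N g] is a combination, with coefficients of absolute value 1,
   of the terms [q ^+ (j * p ^ N) * g (x + j * p ^ N) - g x]. Since [g] is
   uniformly continuous (Z_p is compact) and [q ^+ (p ^ N)] tends to 1, these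
   are uniformly small, and [T_N g] converges by completeness. As
   [[p ^ N]_(-q)] tends to [2 / (1 + q)], the integral is [(1 + q) / 2] times
   [lim T_N g], and the case [n = 1] follows by shifting the index in [T_N];
   the general case is an induction on [n]. *)
Require Import Defs.
From mathcomp Require Import ring.

Set Implicit Arguments.
Unset Strict Implicit.
Unset Printing Implicit Defensive.

Local Open Scope classical_set_scope.
Local Open Scope ring_scope.

(** * Estimates and limits for a non-archimedean absolute value *)

Section Ultrametric.
Context {R : realType} {K : ultrametricFieldType R}.
Implicit Types (x y q : K) (u v : nat -> K).

Lemma absvD_le x y (c : R) : absv x <= c -> absv y <= c -> absv (x + y) <= c.
Proof. by move=> xc yc; apply: le_trans (absvD x y) _; rewrite ge_max xc. Qed.

Lemma absvB_le x y (c : R) : absv x <= c -> absv y <= c -> absv (x - y) <= c.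
Proof. by move=> xc yc; apply: absvD_le; rewrite ?absvN. Qed.

Lemma absvD_lt x y (c : R) : absv x < c -> absv y < c -> absv (x + y) < c.
Proof. by move=> xc yc; apply: le_lt_trans (absvD x y) _; rewrite gt_max xc. Qed.

Lemma absvBC x y : absv (x - y) = absv (y - x).
Proof. by rewrite -absvN opprB. Qed.

Lemma absvX x n : absv (x ^+ n) = absv x ^+ n.
Proof. by elim: n => [|n IH]; rewrite ?absv1 // !exprS absvM IH. Qed.

Lemma absvV x : absv x^-1 = (absv x)^-1.
Proof.
have [->|x0] := eqVneq x 0; first by rewrite invr0 absv0 invr0.
have a0 : absv x != 0 by rewrite absv_eq0.
by apply: (mulfI a0); rewrite -absvM !mulfV ?absv1.
Qed.

Lemma absv_sum_le (I : Type) (r : seq I) (P : pred I) (F : I -> K) (c : R) :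
  0 <= c -> (forall i, P i -> absv (F i) <= c) ->
  absv (\sum_(i <- r | P i) F i) <= c.
Proof.
move=> c0 Fc; elim/big_ind: _ => //; first by rewrite absv0.
by move=> x y; exact: absvD_le.
Qed.

Lemma absv_natr (n : nat) : absv (n%:R : K) <= 1.
Proof. by elim: n => [|n IH]; rewrite ?absv0 // -addn1 natrD absvD_le ?absv1. Qed.

(** If [x] had absolute value below 1, then so would [1 = x - (x - 1)]. *)
Lemma absv_eq1 x : absv (x - 1) < 1 -> absv x = 1.
Proof.
move=> x1; apply/eqP; rewrite eq_le; apply/andP; split.
  by rewrite -(subrK 1 x) absvD_le ?absv1 // ltW.
rewrite leNgt; apply/negP => lx.
suff : absv (1 : K) < 1 by rewrite absv1 ltxx.
by rewrite -[X in absv X](subKr x) absvD_lt ?absvN.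
Qed.

Lemma absv_expB1 q n : absv q <= 1 -> absv (q ^+ n - 1) <= absv (q - 1).
Proof.
move=> q1; rewrite subrX1 absvM ler_piMr ?absv_ge0 // absv_sum_le // => i _.
by rewrite absvX exprn_ile1 ?absv_ge0.
Qed.

Lemma ultrametric_cvgP u x :
  u @ \oo --> x <-> forall e, 0 < e -> \forall n \near \oo, absv (x - u n) < e.
Proof. exact: cvg_ballP. Qed.

Lemma ultrametric_cvgD u v x y :
  u @ \oo --> x -> v @ \oo --> y -> (u n + v n) @[n --> \oo] --> x + y.
Proof.
move=> /ultrametric_cvgP ux /ultrametric_cvgP vy.
apply/ultrametric_cvgP => e e0; near=> n.
rewrite opprD addrACA; apply: absvD_lt; near: n; [exact: ux|exact: vy].
Unshelve. all: by end_near. Qed.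

Lemma ultrametric_cvgM u v x y :
  u @ \oo --> x -> v @ \oo --> y -> (u n * v n) @[n --> \oo] --> x * y.
Proof.
move=> /ultrametric_cvgP ux /ultrametric_cvgP vy.
apply/ultrametric_cvgP => e e0.
have gt0 z : 0 < absv z + 1 :> R by rewrite ltr_pwDr ?absv_ge0.
have lt z w d : 0 < d -> absv (w : K) < d / (absv (z : K) + 1) -> absv (z * w) < d.
  move=> d0; rewrite ltr_pdivlMr // absvM; apply: le_lt_trans.
  by rewrite mulrC ler_wpM2l ?absv_ge0 // lerDl.
near=> n.
(* Each difference is multiplied by a limit or by the other difference, so fixed bounds suffice. *)
have -> : x * y - u n * v n =
    x * (y - v n) + (y * (x - u n) - (x - u n) * (y - v n)) by ring.
apply: absvD_lt; last apply: absvD_lt.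
- by apply: lt => //; near: n; apply: vy; rewrite divr_gt0.
- by apply: lt => //; near: n; apply: ux; rewrite divr_gt0.
rewrite absvN absvM -[e]mul1r; apply: ltr_pM; rewrite ?absv_ge0 //.
- by near: n; exact: ux.
- by near: n; exact: vy.
Unshelve. all: by end_near. Qed.

(** By the strong triangle inequality, if all consecutive differences from [n0] on are below [e],
    every later term is within [e] of [u n0]; the sequence is thus Cauchy. *)
Lemma ultrametric_cvg u : is_complete K ->
  (forall e, 0 < e -> \forall n \near \oo, absv (u n.+1 - u n) < e) ->
  cvg (u @ \oo).
Proof.
move=> Kc uS; apply: Kc; apply/cauchy_ballP => e e0.
have [n0 _ un0] := uS e e0.
have ltu n : (n0 <= n)%N -> absv (u n0 - u n) < e.
  elim: n => [|n IH]; first by rewrite leqn0 => /eqP ->; rewrite subrr absv0.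
  rewrite leq_eqVlt => /predU1P[->|]; first by rewrite subrr absv0.
  rewrite ltnS => nn0.
  by rewrite -(subrKA (u n)) absvD_lt ?IH // absvBC; exact: un0.
exists (u @` [set n | (n0 <= n)%N], u @` [set n | (n0 <= n)%N]) => /=.
  by split; exists n0 => // n /= nn0; exists n.
move=> [_ _] /= [[m m0 <-] [n nn0 <-]].
rewrite /ball /= -(subrKA (u n0)) absvD_lt ?ltu //.
by rewrite absvBC ltu.
Qed.

Lemma cvg_expr_absv_lt (c e : R) :
  0 <= c -> c < 1 -> 0 < e -> \forall n \near \oo, c ^+ n < e.
Proof.
move=> c0 c1 e0; have : (c ^+ n) @[n --> \oo] --> (0 : R).
  by apply: cvg_expr; rewrite ger0_norm.
move/cvgrPdist_lt => /(_ e e0); apply: filterS => n.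
by rewrite sub0r normrN ger0_norm // exprn_ge0.
Qed.

End Ultrametric.

(** * Compactness of Z_p and uniform continuity *)

Section PadicCompactness.
Context {R : realType} {K : ultrametricFieldType R} (p : nat).
Hypotheses (Kc : is_complete K) (p1 : absv (p%:R : K) < 1).
Local Notation c := (absv (p%:R : K)).

(* Compactness of Z_p in the form of an induction principle: a property of the
   residue classes [a + p ^ k * Z_p] holds for Z_p itself if it passes from the
   subclasses to a class and holds for all small classes around each point. *)
Lemma padic_compact_ind (P : nat -> nat -> Prop) :
  (forall a k, (forall j : 'I_p, P (a + j * p ^ k)%N k.+1) -> P a k) ->
  (forall z : vring K, exists k, forall a,
      absv (val z - a%:R) <= c ^+ k -> P a k) ->
  P 0 0.
Proof.
move=> PS Pz; apply: contrapT => nP0.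
(* If [P] fails on a class, [next] gives the digit of a failing subclass; otherwise its value is
   arbitrary. *)
have /choice[next nextP] : forall ak : nat * nat, exists j,
    ~ P ak.1 ak.2 -> ~ P (ak.1 + j * p ^ ak.2)%N ak.2.+1.
  move=> -[a k] /=.
  have [Pak|nPak] := pselect (P a k); first by exists 0%N.
  have /existsNP[j nPj] : ~ forall j : 'I_p, P (a + j * p ^ k)%N k.+1.
    by move=> /PS.
  by exists j.
(* The classes of the [a k] are nested and all fail [P]. The [a k] converge to some [l] in Z_p lying
   in each of these classes, which contradicts [Pz] at [l]. *)
pose a := fix a k :=
  if k is k'.+1 then (a k' + next (a k', k') * p ^ k')%N else 0%N.
have nPa k : ~ P (a k) k by elim: k => // k; exact: (nextP (a k, k)).
have c0 : 0 <= c by exact: absv_ge0.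
have aS k : absv ((a k.+1)%:R - (a k)%:R : K) <= c ^+ k.
  rewrite /= natrD addrAC subrr add0r natrM natrX absvM absvX.
  by rewrite ler_piMl ?absv_natr ?exprn_ge0.
have /cvg_ex[/= l al] : cvg ((a k)%:R @[k --> \oo] : set_system K).
  apply: ultrametric_cvg => // e e0.
  have := cvg_expr_absv_lt c0 p1 e0; apply: filterS => k.
  exact: le_lt_trans.
have ak m k : absv ((a (m + k)%N)%:R - (a k)%:R : K) <= c ^+ k.
  elim: m => [|m IH]; first by rewrite subrr absv0 exprn_ge0.
  rewrite addSn -(subrKA (a (m + k)%N)%:R) absvD_le //.
  by apply: le_trans (aS _) _; apply: ler_wiXn2l; rewrite ?leq_addl ?c0 ?(ltW p1).
have la k : absv (l - (a k)%:R) <= c ^+ k.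
  apply/ler_addgt0Pr => e e0.
  have /ultrametric_cvgP/(_ e e0)[m _ lm] := al.
  rewrite -(subrKA (a (m + k)%N)%:R) absvD_le //.
    by rewrite ler_wpDl ?exprn_ge0 // ltW //; exact: lm (leq_addr k m).
  by rewrite ler_wpDr ?ak // ltW.
have l1 : l \in vint (K:=K).
  by have := la 0%N; rewrite expr0 [_%:R]/= subr0.
by have [k /(_ (a k) (la k))/nPa] := Pz (VRing l1).
Qed.

Lemma vring_val_nat (n : nat) : vring_val (n%:R : vring K) = n%:R.
Proof. exact: (rmorph_nat (val : {rmorphism vring K -> K})). Qed.

Lemma vring_ballE (z w : vring K) (e : R) :
  ball z e w = (absv (vring_val z - vring_val w) < e) :> Prop.
Proof. by []. Qed.

Lemma uniform_continuity_nat {L : ultrametricFieldType R} (f : vring K -> L) e :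
  (0 < p)%N -> (forall z, {for z, continuous f}) -> 0 < e ->
  \forall N \near \oo, forall x j : nat,
    absv (f (x + j * p ^ N)%:R - f x%:R) < e.
Proof.
move=> p_gt0 fc e0.
(* The estimate restricted to [x] in the class of [a] modulo [p ^ k]. It passes up to a class
   because only [p] subclasses, hence [p] thresholds for [N], are involved. *)
pose P (a k : nat) := \forall N \near \oo, forall i j : nat,
  absv (f (a + i * p ^ k + j * p ^ N)%:R - f (a + i * p ^ k)%:R) < e.
suff : P 0%N 0%N.
  by apply: filterS => N fN x j; have := fN x j; rewrite add0n expn0 muln1.
apply: padic_compact_ind => [a k aP|z].
  have : \forall N \near \oo, forall i0 : 'I_p, forall i j : nat,
      absv (f (a + i0 * p ^ k + i * p ^ k.+1 + j * p ^ N)%:R -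
            f (a + i0 * p ^ k + i * p ^ k.+1)%:R) < e.
    exact: filter_forall.
  apply: filterS => N fN i j.
  have := fN (Ordinal (ltn_pmod i p_gt0)) (i %/ p)%N j.
  suff -> : (a + i %% p * p ^ k + i %/ p * p ^ k.+1 = a + i * p ^ k)%N by [].
  by rewrite -addnA expnS mulnA -mulnDl (addnC (i %% p)%N) -divn_eq.
have /cvg_ballP/(_ e e0)/nbhs_ballP[d /= d0 fd] := fc z.
have c0 : 0 <= c by exact: absv_ge0.
have [k _ ck] := cvg_expr_absv_lt c0 p1 d0.
(* For [k <= N], adding [j * p ^ N] stays in the class, where all values of [f] are within [e] of
   [f z]. *)
exists k => a za; exists k => // N kN i j.
have near_z x : absv ((x * p ^ k)%N%:R : K) <= c ^+ k.
  by rewrite natrM natrX absvM absvX ler_piMl ?absv_natr ?exprn_ge0.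
have fz x : absv (f z - f (a + x * p ^ k)%:R) < e.
  apply: fd; rewrite vring_ballE; apply: le_lt_trans (ck k (leqnn k)).
  rewrite vring_val_nat (natrD _ a) opprD addrA absvB_le //.
have -> : (a + i * p ^ k + j * p ^ N = a + (i + j * p ^ (N - k)) * p ^ k)%N.
  by rewrite mulnDl -mulnA -expnD subnK // addnA.
by rewrite -(subrKA (f z)) absvD_lt // absvBC.
Qed.

(** Near [(z, z)] the difference quotient is within 1 of its limit [l], hence bounded by the maximum
    of [absv l] and 1; this gives a Lipschitz bound at [z]. *)
Lemma uniformly_differentiable_continuous {L : ultrametricFieldType R}
    (iota : K -> L) (f : vring K -> L) (z : vring K) :
  is_isometric iota -> uniformly_differentiable iota f ->
  {for z, continuous f}.
Proof.
move=> iotaI /(_ z) /cvg_ex[/= l /cvg_ballP/(_ 1 ltr01)].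
rewrite near_withinE => /nbhs_ballP[d /= d0 fd].
have C0 : 0 < Num.max (absv l) 1 by rewrite lt_max ltr01 orbT.
apply/(cvg_ballP (FF := nbhs_filter z)) => e e0; apply/nbhs_ballP.
exists (Num.min d (e / Num.max (absv l) 1)).
  by rewrite /= lt_min d0 divr_gt0.
move=> y; rewrite vring_ballE lt_min => /andP[zyd zye].
have [<-|zy] := eqVneq z y; first by rewrite /ball /= subrr absv0.
have absvD : absv (iota (val (z - y))) = absv (vring_val z - vring_val y).
  by rewrite iotaI.
have D0 : iota (val (z - y)) != 0.
  by rewrite -absv_eq0 absvD absv_eq0 subr_eq0.
have quot1 := fd (z, y) (conj (ballxx _ d0) zyd) zy.
have quotC : absv ((f z - f y) / iota (val (z - y))) <= Num.max (absv l) 1.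
  rewrite -[X in absv X](subKr l) absvB_le // le_max ?lexx //.
  by apply/orP; right; apply: ltW; exact: quot1.
rewrite /ball /= -[f z - f y](divfK D0) absvM absvD.
apply: le_lt_trans (ler_wpM2r (absv_ge0 _) quotC) _.
by rewrite mulrC -ltr_pdivlMr.
Qed.

End PadicCompactness.

(** * Convergence of the fermionic sums and their behaviour under a shift *)

Section FermionicSums.
Context {R : realType} {K : ultrametricFieldType R} (p : nat) (q : K).
Hypotheses (Kc : is_complete K) (p1 : absv (p%:R : K) < 1).
Hypotheses (p_odd : odd p) (q1 : absv (q - 1) < 1).
Implicit Types g : nat -> K.

(** Uniform continuity for the p-adic topology, on the natural numbers only: these are the points at
    which the sums evaluate a function. *)
Definition padic_ucont g : Prop := forall e, 0 < e ->
  \forall N \near \oo, forall x j, absv (g (x + j * p ^ N)%N - g x) < e.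

Definition fermionic_sum g (N : nat) : K := \sum_(x < p ^ N) g x * (- q) ^+ x.

Let absvq : absv q = 1. Proof. exact: absv_eq1. Qed.

Let p_gt0 : (0 < p)%N. Proof. exact: odd_gt0. Qed.

Lemma padic_ucont_shift g n :
  padic_ucont g -> padic_ucont (fun x => g (x + n)%N).
Proof.
move=> gu e e0; apply: filterS (gu e e0) => N gN x j.
by rewrite addnAC.
Qed.

(** For a suitable [M], [g x] is within 1 of [g (x %% p ^ M)], which takes finitely many values. *)
Lemma padic_ucont_bounded g :
  padic_ucont g -> exists2 B, 0 <= B & forall x, absv (g x) <= B.
Proof.
move=> /(_ 1 ltr01)[M _ /(_ M (leqnn M)) gM].
have S0 : 0 <= \sum_(i < p ^ M) absv (g i).
  by rewrite sumr_ge0 // => i _; exact: absv_ge0.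
exists (1 + \sum_(i < p ^ M) absv (g i)); first by rewrite addr_ge0.
move=> x; have pM0 : (0 < p ^ M)%N by rewrite expn_gt0 p_gt0.
rewrite -(subrK (g (x %% p ^ M)%N) (g x)) absvD_le //.
  rewrite ler_wpDr // ltW // {1}(divn_eq x (p ^ M)) addnC.
  exact: gM.
rewrite ler_wpDl // (bigD1 (Ordinal (ltn_pmod x pM0))) //= lerDl.
by rewrite sumr_ge0 // => i _; exact: absv_ge0.
Qed.

(** The cofactor of [r - 1] in [r ^+ p - 1] is [p] plus terms [r ^+ i - 1], so it is small: a [p]-th
    power brings [r] closer to 1 by a fixed factor. *)
Lemma absv_exp_pS (r : K) : absv (r - 1) <= absv (q - 1) ->
  absv (r ^+ p - 1) <=
    absv (r - 1) * Num.max (absv (p%:R : K)) (absv (q - 1)).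
Proof.
move=> rq; have absvr : absv r = 1 by apply: absv_eq1; exact: le_lt_trans q1.
rewrite subrX1 absvM ler_wpM2l ?absv_ge0 //.
have -> : \sum_(i < p) r ^+ i = p%:R + \sum_(i < p) (r ^+ i - 1).
  by rewrite sumrB sumr_const card_ord addrC subrK.
apply: absvD_le; first by rewrite le_max lexx.
apply: absv_sum_le => [|i _]; first by rewrite le_max absv_ge0.
by apply: le_trans (absv_expB1 _ _) _; rewrite ?absvr // le_max rq orbT.
Qed.

Lemma absv_exp_p (N : nat) :
  absv (q ^+ (p ^ N) - 1) <= Num.max (absv (p%:R : K)) (absv (q - 1)) ^+ N.
Proof.
elim: N => [|N IH]; first by rewrite expn0 expr1 expr0 ltW.
rewrite expnSr exprM; apply: le_trans (absv_exp_pS _) _.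
  by rewrite absv_expB1 ?absvq.
by rewrite exprSr ler_wpM2r // le_max absv_ge0.
Qed.

Lemma cvg_exp_p : q ^+ (p ^ N) @[N --> \oo] --> (1 : K).
Proof.
apply/ultrametric_cvgP => e e0.
have c0 : 0 <= Num.max (absv (p%:R : K)) (absv (q - 1)).
  by rewrite le_max absv_ge0.
have c1 : Num.max (absv (p%:R : K)) (absv (q - 1)) < 1 by rewrite gt_max p1.
have := cvg_expr_absv_lt c0 c1 e0; apply: filterS => N.
by apply: le_lt_trans; rewrite absvBC absv_exp_p.
Qed.

Lemma exprN_odd_exp N : (- q) ^+ (p ^ N) = - q ^+ (p ^ N).
Proof. by rewrite exprNn -signr_odd oddX p_odd orbT expr1 mulN1r. Qed.

Lemma sum_signr m : \sum_(j < m) (-1) ^+ j = (odd m)%:R :> K.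
Proof.
elim: m => [|m IH]; first by rewrite big_ord0.
by rewrite big_ord_recr /= IH -signr_odd; case: odd; rewrite ?subrr ?add0r.
Qed.

(** Indices below [p ^ N.+1] are written [x + j * p ^ N]. As [p] is odd, [(- q) ^+ (p ^ N)] is
    [- q ^+ (p ^ N)], and the signs [(-1) ^+ j] for [j < p] sum to 1, which lets [g x] enter the
    inner sum. *)
Lemma fermionic_sumS g N :
  fermionic_sum g N.+1 - fermionic_sum g N =
    \sum_(x < p ^ N) (- q) ^+ x * \sum_(j < p) (-1) ^+ j *
      (q ^+ (p ^ N) ^+ j * g (x + j * p ^ N)%N - g x).
Proof.
rewrite /fermionic_sum expnS -(big_mkord xpredT (fun x => g x * (- q) ^+ x)).
rewrite big_nat_mul big_mkord.
under eq_bigr => j _ do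
  rewrite -{1}[(j * _)%N]add0n big_addn mulSn addnK big_mkord.
rewrite exchange_big -sumrB; apply: eq_bigr => x _ /=.
under [in RHS]eq_bigr => j _ do rewrite mulrBr.
rewrite sumrB -mulr_suml sum_signr p_odd mul1r mulrBr mulr_sumr.
rewrite [g x * _]mulrC; congr (_ - _); apply: eq_bigr => j _.
rewrite exprD mulnC exprM exprN_odd_exp [(- q ^+ _) ^+ j]exprNn; ring.
Qed.

Lemma cvg_fermionic_sum g : padic_ucont g -> cvg (fermionic_sum g @ \oo).
Proof.
move=> gu; have [B B0 gB] := padic_ucont_bounded gu.
apply: ultrametric_cvg => // e e0.
(* [B + 1] is a positive divisor even if [B = 0]; halving [e] makes the final non-strict bound
   strict. *)
have B1 : 0 < B + 1 by rewrite ltr_wpDl.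
have e2 : 0 < e / 2 by rewrite divr_gt0.
have eB : 0 < e / 2 / (B + 1) by rewrite divr_gt0.
have /ultrametric_cvgP/(_ _ eB) qN := cvg_exp_p.
apply: filterS2 (gu _ e2) qN => N gN qN.
rewrite fermionic_sumS; apply: (@le_lt_trans _ _ (e / 2)).
  apply: absv_sum_le => [|x _]; first exact: ltW.
  rewrite absvM absvX absvN absvq expr1n mul1r.
  apply: absv_sum_le => [|j _]; first exact: ltW.
  rewrite absvM absvX absvN absv1 expr1n mul1r.
  set Q := q ^+ _.
  have -> : Q ^+ j * g (x + j * p ^ N)%N - g x =
      Q ^+ j * (g (x + j * p ^ N)%N - g x) + (Q ^+ j - 1) * g x by ring.
  have absvQ : absv Q = 1 by rewrite absvX absvq expr1n.
  apply: absvD_le; rewrite absvM.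
    by rewrite absvX absvQ expr1n mul1r ltW.
  have -> : e / 2 = e / 2 / (B + 1) * (B + 1) by rewrite divfK // gt_eqF.
  apply: ler_pM; rewrite ?absv_ge0 //.
    by rewrite (le_trans (absv_expB1 _ _)) ?absvQ // absvBC ltW.
  by rewrite ler_wpDr.
by rewrite ltr_pdivrMr // ltr_pMr // ltr1n.
Qed.

(** Since [p] is odd, 1 is [p] minus a multiple of 2; if 2 were small, 1 would be too. *)
Lemma absv_natr2 : absv (2 : K) = 1.
Proof.
apply/eqP; rewrite eq_le absv_natr leNgt; apply/negP => absv2.
suff : absv (1 : K) < 1 by rewrite absv1 ltxx.
have -> : 1 = p%:R - 2 * p./2%:R :> K.
  by rewrite -{1}(odd_double_half p) p_odd -mul2n natrD natrM addrK.
rewrite absvD_lt // absvN absvM; apply: le_lt_trans absv2.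
by rewrite ler_piMr ?absv_ge0 ?absv_natr.
Qed.

Lemma absv_exp_pD1 N : absv (1 + q ^+ (p ^ N)) = 1.
Proof.
have n20 : 2 != 0 :> K by rewrite -absv_eq0 absv_natr2 oner_eq0.
rewrite -[1 + _](divfK n20) absvM absv_natr2 mulr1; apply: absv_eq1.
have -> : (1 + q ^+ (p ^ N)) / 2 - 1 = (q ^+ (p ^ N) - 1) / 2 by field.
rewrite absvM absvV absv_natr2 invr1 mulr1.
by apply: le_lt_trans q1; rewrite absv_expB1 ?absvq.
Qed.

(** As [p ^ N] is odd, the inverse bracket is [(1 + q) / (1 + q ^+ (p ^ N))]. Both 2 and this
    denominator have absolute value 1, so the error is controlled by [1 - q ^+ (p ^ N)]. *)
Lemma cvg_qbracket_inv :
  (qbracket_neg q (p ^ N))^-1 @[N --> \oo] --> (1 + q) / 2.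
Proof.
have n20 : 2 != 0 :> K by rewrite -absv_eq0 absv_natr2 oner_eq0.
have nq0 N : 1 + q ^+ (p ^ N) != 0.
  by rewrite -absv_eq0 absv_exp_pD1 oner_eq0.
have -> : (fun N => (qbracket_neg q (p ^ N))^-1) =
          (fun N => (1 + q) * (1 + q ^+ (p ^ N))^-1).
  apply/funext => N; rewrite /qbracket_neg invf_div.
  by rewrite exprN_odd_exp opprK.
apply: ultrametric_cvgM; first exact: cvg_cst.
apply/ultrametric_cvgP => e e0.
have /ultrametric_cvgP/(_ _ e0) := cvg_exp_p; apply: filterS => N qN.
have -> : 2^-1 - (1 + q ^+ (p ^ N))^-1 =
    - (1 - q ^+ (p ^ N)) / (2 * (1 + q ^+ (p ^ N))).
  by field; rewrite n20 nq0.
by rewrite absvM absvN absvV absvM absv_natr2 absv_exp_pD1 mulr1 invr1 mulr1.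
Qed.

Lemma lim_qbracket_fermionic_sum g (t : K) :
  fermionic_sum g @ \oo --> t ->
  lim ((fun N : nat => (qbracket_neg q (p ^ N))^-1 *
         \sum_(x < p ^ N) g x * (- q) ^+ x) @ \oo) = (1 + q) / 2 * t.
Proof.
move=> gt; apply: cvg_lim; first exact: metric_hausdorff.
exact: ultrametric_cvgM cvg_qbracket_inv gt.
Qed.

Lemma fermionic_sum_shift g N :
  q * fermionic_sum (fun x => g x.+1) N + fermionic_sum g N =
    g 0%N + g (p ^ N)%N * q ^+ (p ^ N).
Proof.
(* The sum with one extra term is evaluated twice, by detaching its last term and then its first. *)
have : \sum_(x < (p ^ N).+1) g x * (- q) ^+ x =
    fermionic_sum g N - g (p ^ N)%N * q ^+ (p ^ N).
  by rewrite big_ord_recr exprN_odd_exp mulrN.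
rewrite big_ord_recl mulr1 /=.
have -> : \sum_(x < p ^ N) g (bump 0 x) * (- q) ^+ bump 0 x =
    - (q * fermionic_sum (fun x => g x.+1) N).
  rewrite /fermionic_sum mulr_sumr -sumrN; apply: eq_bigr => x _.
  by rewrite /bump exprS; ring.
move=> e; rewrite -[fermionic_sum g N](subrK (g (p ^ N)%N * q ^+ (p ^ N))) -e.
ring.
Qed.

Lemma lim_fermionic_sum_shift g (t t' : K) : padic_ucont g ->
  fermionic_sum g @ \oo --> t ->
  fermionic_sum (fun x => g x.+1) @ \oo --> t' ->
  q * t' + t = 2 * g 0%N.
Proof.
move=> gu gt gt'.
have hK : hausdorff_space K by exact: metric_hausdorff.
have gp : g (p ^ N)%N @[N --> \oo] --> g 0%N.
  apply/ultrametric_cvgP => e e0; apply: filterS (gu e e0) => N /(_ 0%N 1%N).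
  by rewrite mul1n add0n absvBC.
have rhs : (g 0%N + g (p ^ N)%N * q ^+ (p ^ N)) @[N --> \oo] -->
    g 0%N + g 0%N * 1.
  by apply: ultrametric_cvgD (ultrametric_cvgM gp cvg_exp_p); exact: cvg_cst.
have lhs : (q * fermionic_sum (fun x => g x.+1) N + fermionic_sum g N)
    @[N --> \oo] --> q * t' + t.
  by apply: ultrametric_cvgD gt; apply: ultrametric_cvgM gt'; exact: cvg_cst.
rewrite mulr_natl mulr2n -[X in _ = _ + X]mulr1.
rewrite -(cvg_lim hK lhs).
rewrite -(cvg_lim hK rhs).
by under eq_fun do rewrite fermionic_sum_shift.
Qed.

End FermionicSums.

(** * The shift formula for the integral over Z_p *)

Lemma padic_abs_nat_lt1 (R : realType) (p : nat) :
  prime p -> padic_abs R p p%:R < 1.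
Proof.
move=> pp; have p0 := prime_gt0 pp.
rewrite -[X in padic_abs _ _ X]/((p : int)%:~R) /padic_abs intr_eq0.
rewrite numq_int denq_int eqz_nat gtn_eqF //= logn1 logn_prime // eqxx.
by rewrite sub0r -exprnN expr1 invf_lt1 ?ltr1n ?ltr0n // prime_gt1.
Qed.

Theorem theorem3 (R : realType) (p : nat) (p_prime : prime p) (p_odd : odd p)
    (Qp Cp : ultrametricFieldType R) (iota : {rmorphism Qp -> Cp})
    (CpP : is_padic_complex_numbers p iota)
    (q : Cp) (q_near1 : absv (q - 1) < 1)
    (f : vring Qp -> Cp) (f_UD : uniformly_differentiable iota f)
    (n : nat) (n_ge1 : (1 <= n)%N) :
  q ^+ n * fermionic_integral p q (fun x => f (x + n%:R)) =
    (-1) ^+ n * fermionic_integral p q f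
    + (1 + q) * \sum_(0 <= l < n) (-1) ^+ (n - 1 - l) * q ^+ l * f l%:R
  /\
  (odd n ->
    q ^+ n * fermionic_integral p q (fun x => f (x + n%:R))
      + fermionic_integral p q f =
    (1 + q) * \sum_(0 <= l < n) (-1) ^+ l * q ^+ l * f l%:R).
Proof.
case: CpP => -[Qpc Qpabs _] [Qb [i [j [_ iI [Cpc jI _] ioj]]]].
have iotaI : is_isometric iota by move=> x; rewrite ioj /= jI iI.
have absvp : absv (p%:R : Qp) < 1.
  by rewrite -(ratr_nat Qp p) Qpabs padic_abs_nat_lt1.
have absvpC : absv (p%:R : Cp) < 1 by rewrite -(rmorph_nat iota) iotaI.
pose g x := f x%:R.
have gu : padic_ucont p g.
  move=> e e0; apply: uniform_continuity_nat => //; first exact: odd_gt0.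
  by move=> z; exact: uniformly_differentiable_continuous iotaI f_UD.
have /choice[t gt] : forall m : nat, exists t : Cp,
    fermionic_sum p q (fun x => g (x + m)%N) @ \oo --> t.
  move=> m; apply/cvg_ex.
  exact: cvg_fermionic_sum (padic_ucont_shift m gu).
have If m : fermionic_integral p q (fun x => f (x + m%:R)) =
    (1 + q) / 2 * t m.
  rewrite -(lim_qbracket_fermionic_sum absvpC p_odd q_near1 (gt m)).
  rewrite /fermionic_integral /g; under eq_fun do
    under eq_bigr do rewrite -natrD; by [].
have If0 : fermionic_integral p q f = (1 + q) / 2 * t 0%N.
  by rewrite -If; congr fermionic_integral; apply/funext => x; rewrite addr0.
have n20 : 2 != 0 :> Cp.
  by rewrite -absv_eq0 (absv_natr2 absvpC p_odd) oner_eq0.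
(* The one-step relation for the function shifted by [m], whose value at 0 is [g m]. *)
have tS m : q * t m.+1 = 2 * g m - t m.
  apply: (canRL (addrK _)); rewrite -[in RHS](add0n m).
  apply: (lim_fermionic_sum_shift absvpC p_odd q_near1
    (padic_ucont_shift m gu) (gt m)).
  rewrite (_ : (fun x => _) = (fun x => g (x + m.+1)%N)) //.
  by apply/funext => x; rewrite addSnnS.
have formula m : q ^+ m * ((1 + q) / 2 * t m) =
    (-1) ^+ m * ((1 + q) / 2 * t 0%N)
    + (1 + q) * \sum_(0 <= l < m) (-1) ^+ (m - 1 - l) * q ^+ l * f l%:R.
  elim: m => [|m IH]; first by rewrite big_nil mulr0 addr0.
  (* Passing to [m.+1] flips every old sign and adds a term of sign 1; [l < m] keeps the truncated
     subtractions exact. *)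
  have sumS : \sum_(0 <= l < m.+1) (-1) ^+ (m.+1 - 1 - l) * q ^+ l * f l%:R =
      q ^+ m * f m%:R -
      \sum_(0 <= l < m) (-1) ^+ (m - 1 - l) * q ^+ l * f l%:R.
    rewrite big_nat_recr //= subn1 /= subnn mul1r addrC; congr (_ + _).
    rewrite -sumrN; apply: eq_big_nat => l /andP[_ lm].
    rewrite subnAC subn1 -[in LHS](@prednK (m - l)) ?subn_gt0 //.
    by rewrite exprS mulN1r !mulNr.
  transitivity (q ^+ m * ((1 + q) / 2 * (q * t m.+1))).
    by rewrite exprSr; ring.
  transitivity ((1 + q) * (q ^+ m * g m) - q ^+ m * ((1 + q) / 2 * t m)).
    by rewrite tS; field.
  by rewrite IH sumS exprS /g; ring.
split; first by rewrite If If0.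
move=> n_odd; rewrite If If0 formula -signr_odd n_odd expr1 mulN1r addrAC addNr.
(* For odd [n], [n - 1 - l] and [l] have the same parity. *)
rewrite add0r; congr (_ * _); apply: eq_big_nat => l /andP[_ ln].
congr (_ * _ * _); rewrite -signr_odd -[RHS]signr_odd; congr (_ ^+ _).
by rewrite -subnDA add1n oddB // n_odd /= negbK.
Qed.
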